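(* Let $k \geq 1$ be an integer. Then $$\mathrm{hc}(B_{2k}) = 2k\Big(2k^3+2k^2-\tfrac{11}{2}k+1\Big)+2, \qquad \mathrm{hc}(B_{2k+1}) = (2k+1)(2k^3+5k^2-2k-1)+2.$$
   Context: For a connected graph $G$ of order $n$, the detour distance $D(u,v)$ is the length of a longest $u$–$v$ path (in a tree, the ordinary distance). A hamiltonian coloring of $G$ is a map $h: V(G)\to\{0,1,2,\ldots\}$ with $D(u,v)+|h(u)-h(v)|\geq n-1$ for all distinct $u,v$; its span is $\max\{|h(u)-h(v)|\}$, and $\mathrm{hc}(G)$ is the minimum span over all hamiltonian colorings. The broom $B_{n,d}$ is the tree on $n$ vertices consisting of a path on $d$ vertices together with $n-d$ additional vertices all adjacent to the same end vertex of the path. Define $B_{2k} = B_{k(2k+1),\,2k}$ and $B_{2k+1} = B_{(k+1)(2k+1),\,2k+1}$. *)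

(* Defs.v *)
From mathcomp Require Import all_boot all_order all_algebra.
From mathcomp Require Import zify.
From mathcomp Require Import boolp.

Set Implicit Arguments.
Unset Strict Implicit.
Unset Printing Implicit Defensive.

Local Open Scope nat_scope.

(* A finite simple graph is a symmetric irreflexive relation on a finType. *)

Section HamiltonianColoring.
Variables (T : finType) (e : rel T).
Implicit Types (u v : T) (h : T -> nat).

(* The vertex sequence of the path is u :: p, so its length in edges is the
   size of p, and it is at most #|T| - 1. *)
Definition has_simple_path u v (l : nat) : bool :=
  [exists p : l.-tuple T, [&& path e u p, last u p == v & uniq (u :: p)]].

Definition detour u v : nat := \max_(l < #|T| | has_simple_path u v l) l.

Definition hamiltonian_coloring h : Prop :=
  forall u v, u != v -> #|T|.-1 <= detour u v + `|h u - h v|.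

Definition color_span h : nat := \max_u \max_v `|h u - h v|.

Definition attained_span : pred nat :=
  fun m => `[< exists h, hamiltonian_coloring h /\ color_span h = m >].

Lemma attained_span_ex : exists m, attained_span m.
Proof.
pose h u : nat := #|T| * enum_rank u.
exists (color_span h); apply/asboolP; exists h; split=> // u v neq_uv.
have neq_r : (enum_rank u : nat) <> enum_rank v.
  by move=> /val_inj/enum_rank_inj/eqP; rewrite (negPf neq_uv).
by rewrite /h; move: (enum_rank u : nat) (enum_rank v : nat) neq_r => a b; nia.
Qed.

Definition hc : nat := ex_minn attained_span_ex.

End HamiltonianColoring.

(* For 1 <= d <= n: the vertices 0, ..., d - 1 form the path, and the vertices
   d, ..., n - 1 are the additional ones, adjacent to the end vertex d - 1. *)
Definition broom_arc (d i j : nat) : bool :=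
  ((j < d) && (j == i.+1)) || ((d <= j) && (i.+1 == d)).

Definition broom (n d : nat) : rel 'I_n :=
  fun i j => broom_arc d i j || broom_arc d j i.
Arguments broom n d : clear implicits.

Lemma broom_sym n d : symmetric (broom n d).
Proof. by move=> i j; rewrite /broom orbC. Qed.

Lemma broom_irrefl n d : irreflexive (broom n d).
Proof. by move=> i; rewrite /broom /broom_arc; lia. Qed.

Lemma broom_connected n d (i j : 'I_n) :
  0 < d <= n -> connect (broom n d) i j.
Proof.
move=> /andP[d0 dn]; have n0 : 0 < n by lia.
suff to0 m (x : 'I_n) : x <= m -> connect (broom n d) x (Ordinal n0).
  apply: connect_trans (to0 _ i (leqnn _)) _.
  by rewrite (sym_connect_sym (@broom_sym n d)) (to0 _ j (leqnn _)).
elim: m x => [|m IHm] x le_xm.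
  by rewrite (_ : x = Ordinal n0) //; apply/val_inj => /=; lia.
have [/eqP x0|x_gt0] := posnP x.
  by apply: IHm; lia.
have lt_y : (if x < d then x.-1 else d.-1) < n by have := ltn_ord x; case: ifP; lia.
apply: (@connect_trans _ _ (Ordinal lt_y)); last by apply: IHm => /=; case: ifP; lia.
by apply: connect1; rewrite /broom /broom_arc /=; case: ifP; lia.
Qed.

(* Main.v *)
Require Import Defs.
From mathcomp Require Import all_boot all_order all_algebra.
From mathcomp Require Import zify lra.
From mathcomp Require Import boolp.

(** Let [L u] be the distance from [u] to the hub of the broom, the vertex that
    carries the additional leaves. A simple path from [u] to [v] has at most
    [L u + L v] edges, so listing the vertices by increasing color and adding
    the constraints of consecutive ones gives
    [span >= (n-1)^2 - 2 * sum L + L first + L last], where the last two terms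
    add up to at least 1 because only the hub has [L = 0].
    For [n >= 2d - 1] there are enough leaves to list the vertices as the hub,
    then path vertices and leaves in alternation, then the remaining leaves;
    consecutive vertices are then at distance exactly [L u + L v], and the greedy
    coloring along this list attains the bound. *)

Set Implicit Arguments.
Unset Strict Implicit.
Unset Printing Implicit Defensive.

Local Open Scope nat_scope.

(** * Detours and span bounds in an arbitrary graph *)

Section Detour.
Variables (T : finType) (e : rel T).
Implicit Types (u v : T) (p : seq T) (h : T -> nat).

Lemma leq_detour u v p :
  path e u p -> last u p = v -> uniq (u :: p) -> size p <= detour e u v.
Proof.
move=> e_p last_p uniq_p.
have lt_p : size p < #|T|.
  by rewrite -[(size p).+1]/(size (u :: p)) -(card_uniqP uniq_p) max_card.
apply: (@leq_bigmax_cond _ _ (fun l : 'I_#|T| => l : nat) (Ordinal lt_p)).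
by apply/existsP; exists (in_tuple p); rewrite /= e_p last_p eqxx.
Qed.

Lemma detour_leq u v m :
    (forall p, path e u p -> last u p = v -> uniq (u :: p) -> size p <= m) ->
  detour e u v <= m.
Proof.
move=> le_m; apply/bigmax_leqP => l /existsP[p /and3P[e_p /eqP last_p uniq_p]].
by rewrite -(size_tuple p) le_m.
Qed.

Lemma detour_sym : symmetric e -> forall u v, detour e u v = detour e v u.
Proof.
move=> e_sym; suff le_sym u v : detour e u v <= detour e v u.
  by move=> u v; apply/eqP; rewrite eqn_leq !le_sym.
apply: detour_leq => p e_p last_p uniq_p.
rewrite -(size_belast u p) -size_rev; apply: leq_detour.
- by rewrite -last_p rev_path (eq_path (e' := e)) // => x y /=; rewrite e_sym.
- by case: p {e_p uniq_p} last_p => [|x p] //= _; rewrite rev_cons last_rcons.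
- by rewrite -last_p -rev_rcons -lastI rev_uniq.
Qed.

Lemma color_span_geq h u v : h v <= h u + color_span h.
Proof.
have le_uv : `|h u - h v| <= color_span h.
  exact: leq_trans (@leq_bigmax T (fun y => `|h u - h y|) v)
                   (@leq_bigmax T (fun x => \max_y `|h x - h y|) u).
lia.
Qed.

Lemma color_span_leq h m : (forall u, h u <= m) -> color_span h <= m.
Proof.
move=> le_m; apply/bigmax_leqP => u _; apply/bigmax_leqP => v _.
by have := le_m u; have := le_m v; lia.
Qed.

(** Summing the gaps along the sorted list, an inner vertex enters two of them and each end only
    one; hence the ends are added back on the left. *)
Lemma sorted_coloring_bound h (L : T -> nat) N x p :
    (forall u v, u != v -> N <= L u + L v + `|h u - h v|) ->
    path (fun u v => h u <= h v) x p -> uniq (x :: p) ->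
  h x + size p * N + L x + L (last x p)
    <= h (last x p) + 2 * \sum_(y <- x :: p) L y.
Proof.
move=> sepN; elim: p x => [|y p IHp] x.
  by rewrite /= big_seq1; lia.
rewrite [path _ _ _]/= [uniq _]/= => /andP[le_xy /IHp{}IHp] /andP[x_notin uniq_p].
have := IHp uniq_p; have neq_xy : x != y by move: x_notin; rewrite inE negb_or => /andP[].
have := sepN _ _ neq_xy; rewrite (big_cons _ _ x) /= mulSn.
lia.
Qed.

Lemma hamiltonian_span_bound h (L : T -> nat) :
    (forall u v, detour e u v <= L u + L v) ->
    (forall u v, u != v -> 0 < L u + L v) ->
    1 < #|T| -> hamiltonian_coloring e h ->
  #|T|.-1 * #|T|.-1 + 1 <= color_span h + 2 * \sum_u L u.
Proof.
move=> detL posL T_gt1 col_h.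
pose r u v := h u <= h v; have r_total : total r by move=> u v; apply: leq_total.
pose s := sort r (enum T).
have perm_s : perm_eq s (enum T) by rewrite perm_sort.
have size_s : size s = #|T| by rewrite (perm_size perm_s) -cardE.
have uniq_s : uniq s by rewrite sort_uniq enum_uniq.
have sort_s : sorted r s := sort_sorted r_total _.
have -> : \sum_u L u = \sum_(u <- s) L u by rewrite (perm_big _ perm_s) big_enum.
case: s size_s uniq_s sort_s {perm_s} => [|x p] size_s uniq_s sort_s.
  by rewrite -size_s in T_gt1.
have sepN u v : u != v -> #|T|.-1 <= L u + L v + `|h u - h v|.
  by move=> /col_h; have := detL u v; lia.
have := sorted_coloring_bound sepN sort_s uniq_s.
have := color_span_geq h x (last x p).
have /posL : x != last x p.
  case: p size_s uniq_s {sort_s} => [|y p] size_s; first by rewrite -size_s in T_gt1.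
  by case/andP=> x_notin _; apply: contraNneq x_notin => ->; exact: (mem_last y p).
have -> : size p = #|T|.-1 by rewrite -size_s.
lia.
Qed.

Lemma hc_unique m h :
    (forall h', hamiltonian_coloring e h' -> m <= color_span h') ->
    hamiltonian_coloring e h -> color_span h <= m ->
  hc e = m.
Proof.
move=> lb col_h le_m; rewrite /hc; case: ex_minnP => s /asboolP[h' [col_h' <-]] s_min.
have := lb _ col_h'; have : color_span h' <= color_span h.
  by apply: s_min; apply/asboolP; exists h.
lia.
Qed.

End Detour.

Local Ltac lia_if := repeat (case: ifP => ?); rewrite /=; lia.

(** * Detour distances in the broom *)

Section Broom.
Variables n d : nat.
Hypotheses (d_gt1 : 1 < d) (d_le : 2 * d - 1 <= n).
Implicit Types (u v : 'I_n) (p : seq 'I_n).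
Local Notation e := (broom n d).

Definition hub_dist (i : nat) : nat := if i < d then d.-1 - i else 1.

(** Clamping by [minn _ d] places every leaf just past the hub [d - 1]; only a pair of leaves
    escapes this picture. *)
Definition broom_dist (i j : nat) : nat :=
  if (i < d) || (j < d) then `|minn i d - minn j d| else 2.

(** Below the hub, [v] has no neighbor other than [v - 1] and [v + 1]; since [u = v + 1] is
    forbidden, the path must keep descending. *)
Lemma downward_path u v p :
    u = v.+1 :> nat -> u < d -> path e v p -> u \notin p -> uniq (v :: p) ->
  last v p + size p = v.
Proof.
elim: p u v => [|w p IHp] u v uv u_lt /=; first by lia.
rewrite inE negb_or => /andP[e_vw e_p] /andP[neq_uw u_notin] /andP[].
rewrite inE negb_or => /andP[neq_vw v_notin] uniq_p.
have vw : v = w.+1 :> nat.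
  by move: neq_uw e_vw; rewrite -val_eqE /broom /broom_arc /=; lia.
have := IHp v w vw _ e_p v_notin uniq_p; lia.
Qed.

Lemma simple_path_size u p :
    path e u p -> uniq (u :: p) ->
  size p <= hub_dist u + hub_dist (last u p).
Proof.
elim: p u => [|v p IHp] u //= /andP[e_uv e_p] /andP[].
rewrite inE negb_or => /andP[neq_uv u_notin] uniq_p.
have := IHp v e_p uniq_p; rewrite /hub_dist.
have [uv|nuv] := eqVneq (u : nat) v.+1.
  have [u_lt|u_ge] := ltnP u d.
    by have := downward_path uv u_lt e_p u_notin uniq_p; lia_if.
  by move: e_uv; rewrite /broom /broom_arc; lia_if.
have [v_lt|v_ge] := ltnP v d.
  by move: e_uv; rewrite /broom /broom_arc; lia_if.
case: p {IHp} e_p u_notin uniq_p => [|w p] /=; first by lia_if.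
rewrite inE negb_or -val_eqE => /andP[e_vw _] /andP[neq_uw _] _.
by move: e_uv e_vw neq_uw; rewrite /broom /broom_arc /=; lia_if.
Qed.

Lemma detour_broom_leq u v : detour e u v <= hub_dist u + hub_dist v.
Proof. by apply: detour_leq => p e_p <-; apply: simple_path_size. Qed.

(** The clamped target lets one induction reach path vertices and leaves alike; the bound [u < w]
    keeps the path simple when it is extended downwards. *)
Lemma upward_path_exists m u v :
    u < d -> minn v d = u + m.+1 ->
  exists p, [/\ size p = m.+1, path e u p, last u p = v,
                all (fun w : 'I_n => u < w) p & uniq (u :: p)].
Proof.
elim: m u => [|m IHm] u u_lt uv.
  exists [:: v]; split=> //=; rewrite ?inE -?val_eqE /broom /broom_arc /=; lia.
have lt_w : u.+1 < n by have := ltn_ord v; lia.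
have w_lt : Ordinal lt_w < d by rewrite /=; lia.
have wv : minn v d = Ordinal lt_w + m.+1 by rewrite /=; lia.
have [p [size_p e_p last_p gt_p uniq_p]] := IHm _ w_lt wv.
have gt_wp : all (fun w : 'I_n => u < w) (Ordinal lt_w :: p).
  by rewrite /= ltnSn; apply: sub_all gt_p => w /=; lia.
exists (Ordinal lt_w :: p); split=> //.
- by rewrite /= size_p.
- by rewrite /= e_p andbT /broom /broom_arc /=; lia.
- rewrite [uniq _]/= -[_ && uniq p]/(uniq (_ :: p)) uniq_p andbT.
  by apply/negP => /(allP gt_wp); rewrite ltnn.
Qed.

Lemma broom_dist_leq_detour u v : u != v -> broom_dist u v <= detour e u v.
Proof.
move=> neq_uv; rewrite -val_eqE /= in neq_uv.
have up (x y : 'I_n) : x < d -> minn x d < minn y d -> broom_dist x y <= detour e x y.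
  move=> x_lt xy; have [|p [size_p e_p last_p _ uniq_p]] :=
    @upward_path_exists (minn y d - x).-1 x y x_lt; first by lia.
  have := leq_detour e_p last_p uniq_p; rewrite size_p /broom_dist; lia_if.
have [uv|vu|uv] := ltngtP (minn u d) (minn v d).
- by apply: up; lia.
- rewrite (detour_sym (@broom_sym n d)) (_ : broom_dist u v = broom_dist v u).
    by apply: up; lia.
  by rewrite /broom_dist; lia_if.
(* Distinct vertices with equal clamped positions are two leaves, joined through the hub. *)
have c_lt : d.-1 < n by lia.
have -> : broom_dist u v = size [:: Ordinal c_lt; v] by rewrite /broom_dist /=; lia_if.
apply: leq_detour => //=; rewrite ?inE -?val_eqE /broom /broom_arc /=; lia.
Qed.

Lemma sum_hub_dist :
  2 * (\sum_(u < n) hub_dist u) = d * d.-1 + 2 * (n - d).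
Proof.
rewrite -(big_mkord xpredT hub_dist) (@big_cat_nat _ _ _ d) //=; last by lia.
rewrite (@eq_big_nat _ _ _ d n hub_dist (fun=> 1)); last first.
  by move=> i; rewrite /hub_dist; lia_if.
rewrite sum_nat_const_nat muln1 mulnDr; congr (_ + _).
rewrite (@eq_big_nat _ _ _ 0 d hub_dist (fun i => d.-1 - i)); last first.
  by move=> i; rewrite /hub_dist; lia_if.
have -> : \sum_(0 <= i < d) (d.-1 - i) = \sum_(0 <= i < d) i.
  rewrite [RHS]big_nat_rev /=; apply: eq_big_nat => i; lia.
elim: d => [|m IHm]; first by rewrite big_nil.
by rewrite big_nat_recr //= mulnDr IHm; case: (m); lia.
Qed.

(** * The greedy coloring along the list *)

(* The place of vertex [i] in the list hub, 0, d, 1, d + 1, ..., d - 2, 2d - 2,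
   2d - 1, 2d, ..., n - 1. *)
Definition position (i : nat) : nat :=
  if i < d.-1 then 2 * i + 1
  else if i == d.-1 then 0
  else if i < 2 * d - 1 then 2 * (i - d) + 2
  else i.

(** A closed form in the place alone, so that colors can be defined by recursion on places without
    inverting [position]. *)
Definition position_hub_dist (j : nat) : nat :=
  if j == 0 then 0
  else if odd j && (j < 2 * d - 1) then d.-1 - j./2 else 1.

Fixpoint position_color (j : nat) : nat :=
  if j is j'.+1 then
    position_color j'
      + (n.-1 - (position_hub_dist j' + position_hub_dist j'.+1))
  else 0.

Definition broom_coloring (u : 'I_n) : nat := position_color (position u).

Lemma position_hub_distE i : position_hub_dist (position i) = hub_dist i.
Proof.
rewrite /position; repeat case: ifP => ?.
all: by rewrite /position_hub_dist /hub_dist; lia_if.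
Qed.

Lemma position_color_mono : {homo position_color : i j / i <= j}.
Proof. by apply: homo_leq leq_trans _ => // j /=; apply: leq_addr. Qed.

Lemma position_hub_dist_even i : 0 < i -> position_hub_dist (2 * i) = 1.
Proof. by rewrite /position_hub_dist; lia_if. Qed.

Lemma position_hub_dist_odd i :
  i < d.-1 -> position_hub_dist (2 * i).+1 = d.-1 - i.
Proof. by rewrite /position_hub_dist; lia_if. Qed.

(** The first [2 * i] gaps pass [i] path vertices, whose decreasing hub distances produce the term
    [i * i]. *)
Lemma position_color_even i : 0 < i < d ->
  position_color (2 * i) + 2 * i * d + i = 2 * i * n.-1 + i * i + 1.
Proof.
(* This keeps the truncated subtractions in [position_color] exact. *)
have N_ge : 2 * d.-1 <= n.-1 by lia.
case: i => // i /andP[_]; elim: i => [|i IHi] i_lt.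
  rewrite /= (_ : 2 = 2 * 1) // position_hub_dist_even //.
  rewrite (@position_hub_dist_odd 0); last by lia.
  by rewrite /position_hub_dist /=; lia.
have := IHi (ltnW i_lt).
have -> : 2 * i.+2 = (2 * i.+1).+2 by lia.
rewrite /= position_hub_dist_even // position_hub_dist_odd; last by lia.
rewrite (_ : (2 * i.+1).+2 = 2 * i.+2) ?position_hub_dist_even //; last by lia.
move: (n.-1) N_ge (position_color _) => N N_ge c; lia.
Qed.

Lemma position_color_last :
  position_color n.-1 + 2 * (n - d) + d * d.-1 = n.-1 * n.-1 + 1.
Proof.
(* From place [2 * d.-1] on there are only leaves, each with hub distance 1. *)
have tail m : position_color (2 * d.-1 + m) = position_color (2 * d.-1) + m * (n.-1 - 2).
  elim: m => [|m IHm]; first by rewrite !addn0.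
  by rewrite addnS /= IHm /position_hub_dist; lia_if.
have := position_color_even (i := d.-1); have := tail (n.-1 - 2 * d.-1).
have -> : 2 * d.-1 + (n.-1 - 2 * d.-1) = n.-1 by lia.
move=> ->; case: d d_gt1 d_le => [|[|d']] // _ n_ge /(_ _); rewrite /=.
have [m n_eq] : exists m, n = m + 2 * d' + 3 by exists (n - 2 * d' - 3); lia.
rewrite n_eq; nia.
Qed.

(** Three consecutive gaps already add up to [n.-1], so only vertices one or two places apart need
    their distance examined. *)
Lemma position_color_far j :
  j.+3 < n -> n.-1 + position_color j <= position_color j.+3.
Proof.
move=> j_lt; rewrite /=; move: (position_color j) => c.
rewrite /position_hub_dist; lia_if.
Qed.

Lemma broom_coloring_hamiltonian : hamiltonian_coloring e broom_coloring.
Proof.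
suff col u v : position u < position v ->
    n.-1 + broom_coloring u <= detour e u v + broom_coloring v.
  move=> u v neq_uv; rewrite card_ord.
  have [/col|/col|eq_pos] := ltngtP (position u) (position v); first by lia.
    by rewrite (detour_sym (@broom_sym n d) u v); lia.
  by move: neq_uv eq_pos; rewrite -val_eqE /position /=; lia_if.
move=> lt_pos; have neq_uv : u != v by apply: contraTneq lt_pos => ->; rewrite ltnn.
have := broom_dist_leq_detour neq_uv; rewrite /broom_coloring.
have [far|near] := leqP (position u + 3) (position v).
  have lt_n : position v < n by have := ltn_ord v; rewrite /position; lia_if.
  have := @position_color_far (position u).
  by move: far; rewrite addn3 => far; have := position_color_mono far; lia.
have [close|close] : position v = (position u).+1 \/ position v = (position u).+2 by lia.
  have := position_hub_distE u; have := position_hub_distE v.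
  rewrite close /= => -> ->; move: close neq_uv.
  rewrite -val_eqE /= /position /hub_dist /broom_dist; lia_if.
(* Two places apart, the distance is only 1 or 2, and [d_le] makes the two gaps supply the rest; the
   hub and leaf [d] give equality when [n = 2 * d - 1]. *)
have := position_hub_distE u; have := position_hub_distE v.
rewrite close /= => -> ->; move: close neq_uv.
rewrite -val_eqE /= /position_hub_dist /position /hub_dist /broom_dist; lia_if.
Qed.

Lemma hc_broom : hc e + 2 * (n - d) + d * d.-1 = n.-1 * n.-1 + 1.
Proof.
rewrite -position_color_last; congr (_ + _ + _).
apply: (@hc_unique _ _ _ broom_coloring).
- move=> h col_h.
  have pos_sum (u v : 'I_n) : u != v -> 0 < hub_dist u + hub_dist v.
    by rewrite -val_eqE /hub_dist /=; lia_if.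
  have n_gt1 : 1 < #|'I_n| by rewrite card_ord; lia.
  have := hamiltonian_span_bound detour_broom_leq pos_sum n_gt1 col_h.
  by rewrite card_ord sum_hub_dist; have := position_color_last; lia.
- exact: broom_coloring_hamiltonian.
- apply: color_span_leq => u; apply: position_color_mono.
  by have := ltn_ord u; rewrite /position; lia_if.
Qed.

End Broom.

(** * Closed forms for the two families *)

Local Open Scope ring_scope.

Theorem theorem5 (k : nat) (hk : (1 <= k)%N) :
  (hc (broom (k * (2 * k + 1)) (2 * k)))%:R
    = 2 * k%:R * (2 * k%:R ^+ 3 + 2 * k%:R ^+ 2 - 11 / 2 * k%:R + 1) + 2 :> rat
  /\
  (hc (broom ((k + 1) * (2 * k + 1)) (2 * k + 1)))%:R
    = (2 * k%:R + 1) * (2 * k%:R ^+ 3 + 5 * k%:R ^+ 2 - 2 * k%:R - 1) + 2 :> rat.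
Proof.
split.
- have := @hc_broom (k * (2 * k + 1)) (2 * k); move: (hc _) => c hcE.
  (* Negative terms are moved left so that no truncated subtraction survives the cast to [rat]. The
     condition [2 * d - 1 <= n] of [hc_broom] holds for [k >= 1], with equality at [k = 1]. *)
  have {hcE} : (c + 11 * (k * k) = 4 * (k * k * k * k) + 4 * (k * k * k) + 2 * k + 2)%N.
    by nia.
  move=> /(congr1 (fun m : nat => m%:R : rat)); rewrite !GRing.natrD !GRing.natrM; lra.
- have := @hc_broom ((k + 1) * (2 * k + 1)) (2 * k + 1); move: (hc _) => c hcE.
  have {hcE} : (c + 4 * k = 4 * (k * k * k * k) + 12 * (k * k * k) + k * k + 1)%N.
    by nia.
  move=> /(congr1 (fun m : nat => m%:R : rat)); rewrite !GRing.natrD !GRing.natrM; lra.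
Qed.
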